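(* Let $N,T\ge1$ be integers and let $\alpha\in(0,1)$ be such that $\alpha T$ is an integer. For any randomized user scheduling algorithm $\pi$, the worst-case age over the horizon $T$ satisfies $$\sup_{\sigma}\ \frac1T\sum_{t=1}^T\frac1N\sum_{i=1}^N \mathbb{E}[a_i(t)]\ \ge\ \frac{T\alpha^2}{2N},$$ where the supremum is over all feasible (deterministic) blocking matrices $\sigma$.
   Context: A base station serves $N$ users over time slots $1,\dots,T$, at most one user per slot. A randomized user scheduling algorithm selects the user to be served in each slot $t$ at random, possibly depending on the past (users served in earlier slots and whether those transmissions succeeded). A blocking matrix is $\sigma\in\{0,1\}^{N\times T}$, chosen by an adversary in advance without seeing the realized actions of the algorithm; $\sigma_i(t)=0$ means the adversary blocks user $i$ in slot $t$, and $\sigma_i(t)=1$ means it does not. It is feasible if $\sum_{i=1}^N\sum_{t=1}^T(1-\sigma_i(t))\le\alpha T$ and $\sum_{i=1}^N(1-\sigma_i(t))\le 1$ for each $t$. Age process: $a_i(1)=1$; $a_i(t+1)=1$ if user $i$ is selected in slot $t$ and $\sigma_i(t)=1$; otherwise $a_i(t+1)=a_i(t)+1$. The expectation is over the randomness of the algorithm. *)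

(* Defs.v *)
From mathcomp Require Import all_boot all_order all_algebra.
From mathcomp Require Import all_classical all_reals all_analysis.

Set Implicit Arguments.
Unset Strict Implicit.
Unset Printing Implicit Defensive.

Import Order.TTheory GRing.Theory Num.Theory.
Local Open Scope classical_set_scope.
Local Open Scope ring_scope.

(* Slots are numbered from 0: the index t stands for slot t + 1 of the
   horizon 1, ..., T. *)

(* What was observed in one slot: the user served (None if the slot is left
   idle) and whether the transmission succeeded.  The past at index t is a
   sequence of t observations, oldest first; its size is the current index, so
   an algorithm reading the past may also depend on time. *)
Definition observation (N : nat) : Type := (option 'I_N * bool)%type.

(* All the randomness of an algorithm is carried by a sample w of a probability
   space, on which every decision may depend in addition to the past; drawing
   fresh randomness in each slot is the case of a product space. *)
Record algorithm (N : nat) (d : measure_display) (Omega : measurableType d) :=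
  Algorithm {
    select :> Omega -> seq (observation N) -> option 'I_N;
    select_measurable : forall (h : seq (observation N)) (u : option 'I_N),
      measurable [set w | select w h = u]
  }.

(* sigma i t = false means that user i is blocked at index t. *)
Definition feasible (R : realType) (N T : nat) (alpha : R)
    (sigma : 'M[bool]_(N, T)) : Prop :=
  (\sum_(i < N) \sum_(t < T) (1 - sigma i t))%N%:R <= alpha * T%:R /\
  forall t : 'I_T, (\sum_(i < N) (1 - sigma i t) <= 1)%N.

(* Entry of sigma at an index given as a natural number; the value at t >= T
   is never used for ages within the horizon. *)
Definition unblocked (N T : nat) (sigma : 'M[bool]_(N, T)) (i : 'I_N)
    (t : nat) : bool :=
  if insub t is Some t' then sigma i t' else true.

Section Dynamics.
Variables (N T : nat) (d : measure_display) (Omega : measurableType d).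
Variables (pi : algorithm N Omega) (sigma : 'M[bool]_(N, T)) (w : Omega).

Fixpoint past (t : nat) : seq (observation N) :=
  if t is s.+1 then
    let u := pi w (past s) in
    rcons (past s) (u, if u is Some i then unblocked sigma i s else false)
  else [::].

Definition selected (t : nat) : option 'I_N := pi w (past t).

Fixpoint age (i : 'I_N) (t : nat) : nat :=
  if t is s.+1 then
    if (selected s == Some i) && unblocked sigma i s then 1%N
    else (age i s).+1
  else 1%N.

End Dynamics.

Definition average_age (R : realType) (N T : nat) (d : measure_display)
    (Omega : measurableType d) (P : probability Omega R)
    (pi : algorithm N Omega) (sigma : 'M[bool]_(N, T)) : \bar R :=
  ((T%:R^-1)%:E * \sum_(t < T) ((N%:R^-1)%:E *
     \sum_(i < N) 'E_P[fun w => (age pi sigma w i t)%:R]))%E.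

(* Main.v *)
(** The adversary blocks a single user in each of the first [k = alpha T] slots.
    Whatever the algorithm does, the age of that user is [t + 1] at every index
    [t < k], so this user alone contributes [1 + ... + k >= k^2 / 2] to the sum
    of the ages. *)
Require Import Defs.
From mathcomp Require Import all_boot all_order all_algebra.
From mathcomp Require Import all_classical all_reals all_analysis.
From mathcomp Require Import ring lra.

Set Implicit Arguments.
Unset Strict Implicit.
Unset Printing Implicit Defensive.

Import Order.TTheory GRing.Theory Num.Theory.
Local Open Scope classical_set_scope.
Local Open Scope ring_scope.

Definition block_prefix (N T : nat) (i0 : 'I_N) (k : nat) : 'M[bool]_(N, T) :=
  \matrix_(i, t) ~~ ((i == i0) && (t < k)%N).

Lemma sum_block_prefix (N T k : nat) (i0 : 'I_N) (t : 'I_T) :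
  (\sum_(i < N) (1 - block_prefix T i0 k i t))%N = (t < k)%N.
Proof.
rewrite (bigD1 i0) //= big1 ?addn0; first by rewrite mxE eqxx; case: (t < k)%N.
by move=> i /negPf ne; rewrite mxE ne.
Qed.

Lemma feasible_block_prefix (R : realType) (N T k : nat) (alpha : R)
    (i0 : 'I_N) :
  k%:R <= alpha * T%:R -> (k <= T)%N ->
  feasible alpha (block_prefix T i0 k).
Proof.
move=> kE leT; split=> [|t]; last by rewrite sum_block_prefix leq_b1.
(* Counted slot by slot, the budget spent is one for each [t < k], hence [k] in total. *)
rewrite exchange_big /= (eq_bigr _ (fun t _ => sum_block_prefix k i0 t)).
rewrite -big_mkcond /= -(big_ord_widen T (fun=> 1%N) leT).
by rewrite sum1_card card_ord.
Qed.

Lemma age_block_prefix (N T k t : nat) (d : measure_display)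
    (Omega : measurableType d) (pi : algorithm N Omega) (w : Omega)
    (i0 : 'I_N) :
  (k <= T)%N -> (t < k)%N ->
  age pi (block_prefix T i0 k) w i0 t = t.+1.
Proof.
move=> leT; elim: t => [//|t IHt] /ltnW tk /=.
(* Since [t < k <= T], [unblocked] reads an actual entry of the matrix and not its default [true];
   that entry is [false], so no choice of [pi] resets the age. *)
rewrite IHt // /unblocked insubT ?(leq_trans tk) // => tT.
by rewrite mxE eqxx /= tk andbF.
Qed.

(** Passing from [k] to [k + 1] adds [k + 1] on the right but only [k + 1/2] on the left. *)
Lemma sum_succ_ge (R : realType) (k : nat) :
  k%:R ^+ 2 / 2 <= \sum_(t < k) t.+1%:R :> R.
Proof.
elim: k => [|k IHk]; first by rewrite big_ord0 expr0n mul0r.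
rewrite big_ord_recr /= -natr1; lra.
Qed.

Lemma average_age_block_prefix (R : realType) (N T k : nat)
    (d : measure_display) (Omega : measurableType d) (P : probability Omega R)
    (pi : algorithm N Omega) (i0 : 'I_N) :
  (k <= T)%N ->
  ((T%:R^-1 * (N%:R^-1 * \sum_(t < k) t.+1%:R))%:E <=
     average_age P pi (block_prefix T i0 k))%E.
Proof.
move=> leT; rewrite /average_age EFinM.
apply: lee_wpmul2l; first by rewrite lee_fin invr_ge0.
rewrite mulr_sumr (big_ord_widen T (fun t => N%:R^-1 * t.+1%:R)) // -sumEFin.
rewrite big_mkcond; apply: lee_sum => t _.
have E0 i : (0 <= 'E_P[fun w => (age pi (block_prefix T i0 k) w i t)%:R])%E.
  by apply: expectation_ge0 => w; rewrite ler0n.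
case: ifP => tk; last first.
  by apply: mule_ge0; [rewrite lee_fin invr_ge0|apply: sume_ge0].
rewrite EFinM; apply: lee_wpmul2l; first by rewrite lee_fin invr_ge0.
rewrite (bigD1 i0) //=.
(* The age of [i0] is the same for every sample [w], so its expectation is that constant. *)
under eq_fun do rewrite age_block_prefix //.
by rewrite expectation_cst leeDl // sume_ge0.
Qed.

Theorem lemma2 (R : realType) (N T : nat) (alpha : R)
    (d : measure_display) (Omega : measurableType d) (P : probability Omega R)
    (pi : algorithm N Omega) :
  (1 <= N)%N -> (1 <= T)%N ->
  0 < alpha < 1 -> alpha * T%:R \is a Num.int ->
  ((T%:R * alpha ^+ 2 / (2 * N%:R))%:E <=
     ereal_sup [set average_age P pi sigma
               | sigma in [set sigma : 'M[bool]_(N, T) | feasible alpha sigma]])%E.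
Proof.
move=> N1 T1 /andP[a0 a1] aTint.
have T0 : 0 < T%:R :> R by rewrite ltr0n.
have N0 : 0 < N%:R :> R by rewrite ltr0n.
(* Integrality of [alpha * T] lets the adversary spend the whole budget on [k] full slots. *)
have /natrP[k kE] : alpha * T%:R \is a Num.nat.
  by rewrite Num.Theory.natrEint aTint mulr_ge0 // ltW.
have leT : (k <= T)%N by rewrite -(ler_nat R) -kE ler_piMl // ltW.
pose i0 := Ordinal N1.
apply: (@le_trans _ _ (average_age P pi (block_prefix T i0 k))); last first.
  apply: ereal_sup_ubound; exists (block_prefix T i0 k) => //=.
  by apply: feasible_block_prefix => //; rewrite kE.
apply: le_trans (average_age_block_prefix P pi i0 leT); rewrite lee_fin.
(* Substituting [alpha * T = k] turns the target into [k ^ 2 / (2 * T * N)]. *)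
have -> : T%:R * alpha ^+ 2 / (2 * N%:R)
    = T%:R^-1 * (N%:R^-1 * (k%:R ^+ 2 / 2)).
  by rewrite -kE; field; rewrite !gt_eqF.
by do 2![apply: ler_wpM2l; first by rewrite invr_ge0 ltW]; apply: sum_succ_ge.
Qed.
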